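(* If $k\ge 3$ is an integer and $G$ is a chordal graph on $n$ vertices with clique number $\omega$, then $$\psi_k(G) \le \frac{\omega}{\omega+k-1}\; n.$$
   Context: Graphs are finite, simple and undirected. A graph is chordal if it contains no induced cycle on more than three vertices. $P_k$ denotes the path with $k$ vertices. A $k$-path vertex cover of $G$ is a set $T\subseteq V(G)$ such that $G-T$ contains no (not necessarily induced) subgraph isomorphic to $P_k$. $\psi_k(G)$ is the minimum cardinality of a $k$-path vertex cover of $G$. *)

(* Defs.v *)
From mathcomp Require Import all_boot all_order all_algebra.
Set Implicit Arguments.
Unset Strict Implicit.
Unset Printing Implicit Defensive.

Record sgraph := SGraph {
  vertex :> finType;
  adj : rel vertex;
  adj_sym : symmetric adj;
  adj_irrefl : irreflexive adj
}.

Section PathAndCycle.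
Variable k : nat.

Definition path_adj : rel 'I_k :=
  fun i j => (i.+1 == j :> nat) || (j.+1 == i :> nat).

Fact path_adj_sym : symmetric path_adj.
Proof. by move=> i j; apply: orbC. Qed.

Fact path_adj_irrefl : irreflexive path_adj.
Proof. by move=> i; rewrite /path_adj orbb gtn_eqF. Qed.

Definition path_graph : sgraph := SGraph path_adj_sym path_adj_irrefl.

(* The cycle 0 - 1 - ... - (k-1) - 0; it is a cycle only for k >= 3.  The
   condition i != j just excludes the loop that would occur for k = 1. *)
Definition cycle_adj : rel 'I_k :=
  fun i j => (i != j) && ((i.+1 %% k == j :> nat) || (j.+1 %% k == i :> nat)).

Fact cycle_adj_sym : symmetric cycle_adj.
Proof. by move=> i j; rewrite /cycle_adj eq_sym orbC. Qed.

Fact cycle_adj_irrefl : irreflexive cycle_adj.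
Proof. by move=> i; rewrite /cycle_adj eqxx. Qed.

Definition cycle_graph : sgraph := SGraph cycle_adj_sym cycle_adj_irrefl.

End PathAndCycle.

Definition has_subgraph (H G : sgraph) : bool :=
  [exists f : {ffun H -> G}, injectiveb f &&
     [forall x, forall y, adj x y ==> adj (f x) (f y)]].

Definition has_induced_subgraph (H G : sgraph) : bool :=
  [exists f : {ffun H -> G}, injectiveb f &&
     [forall x, forall y, adj (f x) (f y) == adj x y]].

Definition chordal (G : sgraph) : Prop :=
  forall l : nat, 3 < l -> ~~ has_induced_subgraph (cycle_graph l) G.

Section Invariants.
Variable G : sgraph.

Definition clique (S : {set G}) : bool :=
  [forall x in S, forall y in S, (x != y) ==> adj x y].

Definition clique_number : nat := \max_(S : {set G} | clique S) #|S|.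

Section Deletion.
Variable S : {set G}.

Definition del_adj : rel {x : G | x \notin S} :=
  fun x y => adj (val x) (val y).

Fact del_adj_sym : symmetric del_adj.
Proof. by move=> x y; apply: adj_sym. Qed.

Fact del_adj_irrefl : irreflexive del_adj.
Proof. by move=> x; apply: adj_irrefl. Qed.

Definition del_vertices : sgraph := SGraph del_adj_sym del_adj_irrefl.

End Deletion.

Definition path_vertex_cover (k : nat) (S : {set G}) : bool :=
  ~~ has_subgraph (path_graph k) (del_vertices S).

(* For k > 0 the whole vertex set is a cover, so this is a true minimum (see
   psiP); for k = 0 there is no cover and the value is meaningless. *)
Definition psi (k : nat) : nat :=
  #|[arg min_(S < [set: G] | path_vertex_cover k S) #|S|]|.

Lemma path_vertex_coverT (k : nat) : 0 < k -> path_vertex_cover k [set: G].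
Proof.
case: k => // k _; apply/existsPn => f.
by have := valP (f ord0); rewrite inE.
Qed.

Lemma psiP (k : nat) : 0 < k ->
  (exists2 S : {set G}, path_vertex_cover k S & #|S| = psi k) /\
  (forall S : {set G}, path_vertex_cover k S -> psi k <= #|S|).
Proof.
move=> k_gt0; rewrite /psi.
by case: arg_minnP => [|S covS minS]; [exact: path_vertex_coverT | split=> //; exists S].
Qed.

End Invariants.

(* Main.v *)
Require Import Defs.
From mathcomp Require Import all_boot all_order all_algebra.
From mathcomp Require Import zify.

(** The bound follows from a deletion argument that pays for every deleted
clique with a large connected piece of the graph.  Let [omega] be the clique
number.

Work inside a vertex set [W], initially everything.  If no connected subset of
[W] has [k] vertices, there is nothing to delete.  Otherwise, some connected
[D] in [W] has at least [k] vertices and a clique [K] as its neighbourhood in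
[W] (a component of [W] is one, with [K] empty); take such a [D] with the
fewest vertices.  In a chordal graph some vertex [v] of [D] is adjacent to all
of [K] ([chordal_complete_vertex]), so [v |: K] is a clique.  A component of
[D :\ v] again has its neighbourhood inside the clique [v |: K], hence has
fewer than [k] vertices by the minimality of [D] ([chordal_separator]).

Delete [v |: K] and recurse on [W] without [D] and [K]
([chordal_fragmentation]).  The step uses [#|K| + 1 <= omega] deletions
and consumes at least [#|K| + k] vertices; since [x / (x + k - 1)] increases with
[x], the ratio of the two is at most [omega / (omega + k - 1)].  In the end every
connected set that avoids the deleted vertices has fewer than [k] vertices,
so in particular no path on [k] vertices is left.

The complete vertex is found as follows.  If [x] and [y] are adjacent and both
have neighbours in a connected set that avoids them, then they have a common
neighbour there, since otherwise a shortest path between their neighbours would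
close up to an induced cycle of length at least four
([chordal_common_neighbour]).  Now take [v] in [D] with the most neighbours
in [K], and suppose that it misses [y] in [K].  Let [E] be the component of [v]
in [D] minus the neighbours of [y], and [w] a neighbour of [y] in [D] adjacent
to [E].  In [w |: E] only [w] is adjacent to [y], so [w] is the common
neighbour of [y] and each neighbour [x] of [v] in [K]; thus [w] has more
neighbours in [K] than [v], a contradiction. *)

Set Implicit Arguments.
Unset Strict Implicit.
Unset Printing Implicit Defensive.

Import GRing.Theory Num.Theory.

(** * Connected vertex sets *)

Section Connected.
Variable G : sgraph.
Implicit Types (A C D E K S U W : {set G}) (a b c u v w x y z : G).

Definition closed_in C A : bool :=
  [forall a in A, forall b in C, adj a b ==> (b \in A)].

(** Connectedness by cuts: [C] has no proper nonempty part without an edge to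
the rest.  In this form growing a set by a neighbour, and maximality arguments,
need no walks; [connected_path] recovers them.  The empty set is connected. *)
Definition connected C : bool :=
  [forall A : {set G},
     (A \subset C) ==> (A != set0) ==> closed_in C A ==> (A == C)].

Definition nbhd_in W D : {set G} :=
  [set x in W :\: D | [exists d in D, adj d x]].

Lemma closed_inP C A :
  reflect {in A & C, forall a b, adj a b -> b \in A} (closed_in C A).
Proof.
apply: (iffP forall_inP) => [H a b aA bC ab | H a aA].
  by have /forall_inP/(_ b bC)/implyP := H a aA; apply.
by apply/forall_inP => b bC; apply/implyP; apply: H.
Qed.

Lemma connectedP C :
  reflect (forall A, A \subset C -> A != set0 -> closed_in C A -> A = C)
          (connected C).
Proof.
apply: (iffP forallP) => [H A sAC A0 clA | H A].
  by move: (H A); rewrite sAC A0 clA => /eqP.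
by apply/implyP=> ?; apply/implyP=> ?; apply/implyP=> ?; apply/eqP/H.
Qed.

Lemma nbhd_inP W D x :
  reflect [/\ x \in W, x \notin D & exists2 d, d \in D & adj d x]
          (x \in nbhd_in W D).
Proof.
rewrite !inE; apply: (iffP andP) => [[/andP[xD xW] /exists_inP] | [xW xD H]].
  by split.
by rewrite xW xD; split=> //; apply/exists_inP.
Qed.

Lemma connected1 v : connected [set v].
Proof.
apply/connectedP => A; rewrite subset1 => /orP[/eqP-> // | /eqP->].
by rewrite eqxx.
Qed.

Lemma connectedU1 C c u :
  connected C -> c \in C -> adj c u -> connected (u |: C).
Proof.
move=> /connectedP conC cC cu; apply/connectedP => A sA /set0Pn[a aA] clA.
have {}clA := closed_inP _ _ clA.
have AC_C : A :&: C != set0 -> A :&: C = C.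
  move=> AC0; apply: conC AC0 _; first exact: subsetIr.
  apply/closed_inP => x y /setIP[xA xC] yC xy.
  by rewrite inE yC (clA x) // inE yC orbT.
suff /AC_C/setIidPr sCA : A :&: C != set0.
  apply/eqP; rewrite eqEsubset sA subUset sub1set sCA andbT.
  by apply: (clA c); rewrite ?setU11 //; apply: (subsetP sCA).
apply/set0Pn; have /setU1P[au | aC] := subsetP sA a aA; last first.
  by exists a; rewrite inE aA.
exists c; rewrite inE cC (clA u) ?andbT -?au //; first by rewrite inE cC orbT.
by rewrite au adj_sym.
Qed.

(** A maximal connected set [E] between [C] and [U] is a component of [U],
because adding a neighbour would keep it connected. *)
Lemma connected_component C U :
    connected C -> C \subset U ->
  exists E, [/\ connected E, C \subset E, E \subset U &
                C != set0 -> nbhd_in U E = set0].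
Proof.
move=> conC sCU; pose P E := [&& connected E, C \subset E & E \subset U].
have [|E /maxsetP[/and3P[conE sCE sEU] maxE] _] := @maxset_exists _ P C.
  by rewrite /P conC subxx.
exists E; split=> // _; apply/eqP; rewrite -subset0; apply/subsetP => u.
case/nbhd_inP=> uU uE [c cE cu]; case/negP: uE.
rewrite -(maxE (u |: E)) ?subsetUr ?setU11 // /P (connectedU1 conE cE cu).
by rewrite subsetU ?sCE ?orbT // subUset sub1set uU.
Qed.

Lemma connected_walk (f : nat -> G) n :
    (forall i, i < n -> adj (f i) (f i.+1)) ->
  connected [set f (val i) | i : 'I_n.+1].
Proof.
elim: n => [|n IHn] adjf.
  have -> : [set f (val i) | i : 'I_1] = [set f 0].
    apply/setP => z; rewrite inE; apply/imsetP/eqP => [[i _ ->] | ->].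
      by rewrite ord1.
    by exists ord0.
  exact: connected1.
have -> : [set f (val i) | i : 'I_n.+2] =
          f n.+1 |: [set f (val i) | i : 'I_n.+1].
  apply/setP => z; rewrite !inE; apply/imsetP/orP.
    case=> i _ ->; case: (ltnP i n.+1) => [lt_i | le_i]; [right | left].
      by apply/imsetP; exists (Ordinal lt_i).
    by apply/eqP; congr f; apply/eqP; rewrite eqn_leq le_i -ltnS ltn_ord.
  case=> [/eqP-> | /imsetP[i _ ->]]; first by exists ord_max.
  by exists (widen_ord (leqnSn _) i).
apply: (@connectedU1 _ (f n)); last exact: adjf.
  by apply: IHn => i lt_i; apply: adjf; apply: ltnW.
by apply/imsetP; exists ord_max.
Qed.

(** The vertices of [C] reachable from [a] inside [C] form a nonempty closed
part, hence all of [C]. *)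
Lemma connected_path C a b :
    connected C -> a \in C -> b \in C ->
  exists p, [/\ path (@adj G) a p, last a p = b & {subset p <= C}].
Proof.
move=> /connectedP conC aC bC.
pose r : rel G := [rel x y | adj x y && (y \in C)].
have /setP/(_ b) : [set z in C | connect r a z] = C.
  apply: conC; first by apply/subsetP=> z; rewrite inE => /andP[].
    by apply/set0Pn; exists a; rewrite inE aC connect0.
  apply/closed_inP => x y; rewrite !inE => /andP[_ ax] yC xy; rewrite yC /=.
  by apply: connect_trans ax (connect1 _); apply/andP.
rewrite inE bC /= => /connectP[p rp ->]; exists p.
elim: p a {aC} rp => //= z p IHp a /andP[/andP[az zC] /IHp[pz _ sp]].
split=> //; first by rewrite az.
by move=> w; rewrite inE => /predU1P[-> | /sp].
Qed.

Lemma connected_nbhd0 D E :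
    connected D -> E \subset D -> E != set0 -> nbhd_in D E = set0 -> E = D.
Proof.
move=> /connectedP conD sED E0 nb0; apply: conD => //.
apply/closed_inP => x y xE yD xy; apply: contraT => yE.
suff : y \in nbhd_in D E by rewrite nb0 inE.
by apply/nbhd_inP; split=> //; exists x.
Qed.

(** To leave [D] inside [W], a connected set has to use a vertex of the
neighbourhood of [D]. *)
Lemma connected_confined W D C c :
    connected C -> C \subset W -> [disjoint C & nbhd_in W D] ->
  c \in C -> c \in D -> C \subset D.
Proof.
move=> /connectedP conC sCW dis cC cD; apply/setIidPl.
apply: conC; first exact: subsetIl.
  by apply/set0Pn; exists c; rewrite inE cC.
apply/closed_inP => x y /setIP[xC xD] yC xy; rewrite inE yC /=.
apply: contraFT (disjointFr dis yC) => yD; apply/nbhd_inP.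
by split; [exact: (subsetP sCW) | | exists x].
Qed.

End Connected.

(** * Cliques and the weight of one deletion step *)

Section Cliques.
Variable G : sgraph.
Implicit Types (K U : {set G}) (v : G).

Lemma clique_number_max K : clique K -> #|K| <= clique_number G.
Proof. exact: leq_bigmax_cond. Qed.

Lemma cliqueS K U : U \subset K -> clique K -> clique U.
Proof.
move=> sUK /forall_inP cK; apply/forall_inP => x /(subsetP sUK)/cK/forall_inP H.
by apply/forall_inP => y /(subsetP sUK)/H.
Qed.

Lemma clique_cone K v :
  clique K -> {in K, forall x, adj v x} -> clique (v |: K).
Proof.
move=> /forall_inP cK vK; apply/forall_inP => x xK; apply/forall_inP => y yK.
apply/implyP; case/setU1P: xK => [-> | xK]; case/setU1P: yK => [-> | yK].
- by rewrite eqxx.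
- by rewrite vK.
- by rewrite adj_sym vK.
by have /forall_inP/(_ y yK)/implyP := cK x xK.
Qed.

End Cliques.

(** The accounting of one deletion step: [d] and [c] are the sizes of the
connected piece and of its neighbourhood, [w] is the clique number, and [s']
deletions suffice for the remaining [r] vertices.  It holds since
[c.+1 * (w + k.-1) <= w * (c + k)], that is, [c.+1 * k.-1 <= w * k.-1]. *)
Lemma deletion_count (k d c s' s w r : nat) :
    0 < k -> k <= d -> c < w -> s' * (w + k.-1) <= w * r -> s <= c.+1 + s' ->
  s * (w + k.-1) <= w * (d + c + r).
Proof.
case: k => // k _ /= lt_kd lt_cw le_s' le_s.
apply: leq_trans (leq_mul le_s (leqnn _)) _.
rewrite mulnDl [leqRHS]mulnDr leq_add //.
have le_ck : c.+1 * k <= w * k by rewrite leq_mul.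
have le_wd : w * k.+1 <= w * d by rewrite leq_mul.
by rewrite !mulnDr mulSn mulnS in le_wd *; lia.
Qed.

(** * Separating cliques in chordal graphs *)

Section Chordal.
Variable G : sgraph.
Hypothesis chordalG : chordal G.
Implicit Types (C D E K S U W : {set G}) (a b c u v w x y z : G).

(** A walk from [q 0] to [q l] through [D] that is as short as possible has no
chord except the edge that joins its ends, and so closes up to an induced cycle,
which chordality rules out unless the walk has a single inner vertex.  Walks are
functions on [nat] because cutting off a detour is then a mere shift of the
argument; repetitions are allowed, since chordlessness excludes them. *)
Lemma chordal_walk (l : nat) (q : nat -> G) D :
    1 < l -> adj (q 0) (q l) -> q 0 \notin D -> q l \notin D ->
    (forall i, i < l -> adj (q i) (q i.+1)) ->
    (forall i, 0 < i < l -> q i \in D) ->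
  exists2 c, c \in D & adj (q 0) c && adj (q l) c.
Proof.
have [m] := ubnP l; elim: m l q => // m IHm l q lt_lm l_gt1 q0l q0D qlD adjq inD.
have [l_eq2 | l_neq2] := eqVneq l 2.
  exists (q 1); first by apply: inD; lia.
  rewrite [adj (q l) _]adj_sym l_eq2.
  by apply/andP; split; apply: adjq; rewrite l_eq2.
pose chord (i j : 'I_l.+1) :=
  [&& i.+1 < j, (0 < i) || (j < l) & adj (q i) (q j)].
(* A chord from position i to position j bypasses the vertices in between. *)
have [/existsP[i /existsP[j /and3P[lt_ij nend qij]]] | nochord] :=
  boolP [exists i, exists j, chord i j].
  have le_jl : j <= l by rewrite -ltnS.
  pose d := j - i.+1; pose q' t := if t <= i then q t else q (t + d).
  have q'0 : q' 0 = q 0 by [].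
  have q'l : q' (l - d) = q l.
    by rewrite /q' ifF; [congr q; rewrite /d | rewrite /d]; lia.
  rewrite -q'l -q'0; apply: IHm; rewrite ?q'0 ?q'l //; rewrite ?/d; try lia.
    move=> t lt_t; rewrite /q'; case: (ltngtP t i) => [lt_ti | gt_ti | ->].
    - by apply: adjq; lia.
    - by rewrite addSn; apply: adjq; lia.
    by have -> : i.+1 + d = j by rewrite /d; lia.
  by move=> t lt_t; rewrite /q'; case: ifP => le_ti; apply: inD; lia.
have chordless i j : i.+1 < j -> j <= l -> (0 < i) || (j < l) ->
    adj (q i) (q j) = false.
  move=> lt_ij le_jl nend; apply: contraNF nochord => qij.
  have lt_il : i < l.+1 by lia.
  apply/existsP; exists (Ordinal lt_il); apply/existsP.
  by exists (Ordinal (le_jl : j < l.+1)); rewrite /chord /= lt_ij nend qij.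
have adjE i j : i < j -> j <= l ->
    adj (q i) (q j) = (i.+1 == j) || (i == 0) && (j == l).
  move=> lt_ij le_jl; have [<- | ne_ij] /= := eqVneq i.+1 j.
    by apply: adjq; lia.
  case: eqP => [-> | ne_i0]; last by rewrite chordless //; lia.
  by case: eqP => [-> | ne_jl] //; rewrite chordless //; lia.
(* If q i = q j, then the next edge, from q j to q (j + 1), is a chord at i; it
   is missing or an allowed edge only if q i or q j is an end of the walk, and
   the ends are distinct and lie outside D. *)
have q_neq i j : i < j -> j <= l -> q i != q j.
  move=> lt_ij le_jl; apply/eqP => eq_ij.
  have [eq_jl | ne_jl] := eqVneq j l.
    have [i_eq0 | i_neq0] := eqVneq i 0.
      by move: q0l; rewrite -eq_jl -eq_ij i_eq0 adj_irrefl.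
    by case/negP: qlD; rewrite -eq_jl -eq_ij; apply: inD; lia.
  have lt_jl : j < l by lia.
  have := adjq j lt_jl; rewrite -eq_ij adjE //; try lia.
  have [i_eq0 _ | i_neq0] := eqVneq i 0; last lia.
  by case/negP: q0D; rewrite -i_eq0 eq_ij; apply: inD; lia.
have l3 : 3 < l.+1 by lia.
case/negP: (chordalG l3); apply/existsP; exists [ffun i : 'I_l.+1 => q i].
have cycE (i j : 'I_l.+1) : i < j ->
    cycle_adj i j = (i.+1 == j :> nat) || (i == 0 :> nat) && (j == l :> nat).
  move=> lt_ij; have le_jl : j <= l by rewrite -ltnS.
  have ne_ij : i != j by rewrite -val_eqE /= neq_ltn lt_ij.
  rewrite /cycle_adj ne_ij modn_small /=; last lia.
  have [-> | ne_jl] := eqVneq (j : nat) l; first by rewrite modnn; lia.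
  by rewrite modn_small; lia.
apply/andP; split.
  apply/injectiveP => i j; rewrite !ffunE => /eqP eq_ij; apply/val_inj/eqP.
  apply: contraTT eq_ij => /=; rewrite neq_ltn => /orP[] lt_ij.
    by apply: q_neq => //; rewrite -ltnS.
  by rewrite eq_sym; apply: q_neq => //; rewrite -ltnS.
apply/forallP => i; apply/forallP => j; rewrite !ffunE; apply/eqP => /=.
have [lt_ij | lt_ji | /val_inj->] := ltngtP i j.
- by rewrite cycE // adjE // -ltnS.
- by rewrite adj_sym cycle_adj_sym cycE // adjE // -ltnS.
by rewrite adj_irrefl cycle_adj_irrefl.
Qed.

(** Close a path of [D] between neighbours of [x] and of [y] to a walk from [x]
to [y] and shorten it. *)
Lemma chordal_common_neighbour D x y a b :
    connected D -> adj x y -> x \notin D -> y \notin D ->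
    a \in D -> adj x a -> b \in D -> adj y b ->
  exists2 c, c \in D & adj x c && adj y c.
Proof.
move=> conD xy xD yD aD xa bD yb.
have [p [pa pb sp]] := connected_path conD aD bD.
have nth_rcons_default s i : nth y (rcons s y) i = nth y s i.
  by rewrite nth_rcons; case: ltngtP => // [? | ->]; rewrite nth_default // ltnW.
(* The default value of nth is the end y of the walk. *)
pose q := nth y [:: x, a & p]; pose l := (size p).+2.
have ql : q l = y by rewrite /q nth_default.
rewrite -ql; apply: (@chordal_walk l q); rewrite ?ql // => i lt_i.
  have : path (@adj G) x (a :: rcons p y) by rewrite /= xa rcons_path pa pb adj_sym.
  move=> /(pathP y)/(_ i); rewrite /= size_rcons => /(_ lt_i).
  by rewrite -!rcons_cons !nth_rcons_default.
case: i lt_i => [|[|i]] //= lt_i; apply: sp; apply: mem_nth; move: lt_i.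
by rewrite /l !ltnS.
Qed.

(** A vertex of [D] with the most neighbours in [K] is adjacent to all of [K]:
if it missed [y], walking in [D] towards the neighbours of [y], the first one
reached would see [y] and lose none of the old neighbours. *)
Lemma chordal_complete_vertex D K :
    connected D -> D != set0 -> clique K -> [disjoint K & D] ->
    {in K, forall x, exists2 d, d \in D & adj d x} ->
  exists2 v, v \in D & {in K, forall x, adj v x}.
Proof.
move=> conD /set0Pn[d dD] cliqueK disKD nbrK.
pose deg v := #|[set x in K | adj v x]|.
have [v vD maxv] := arg_maxnP (P := mem D) deg dD.
have {}vD : v \in D := vD; exists v => // y yK.
apply: contraT => vy.
(* The part of D reachable from v before the walk meets a neighbour of y. *)
have [||E [conE vE sED nbE]] :=
  @connected_component G [set v] [set z in D | ~~ adj z y].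
- exact: connected1.
- by rewrite sub1set inE vD.
have {}nbE : nbhd_in [set z in D | ~~ adj z y] E = set0.
  by apply: nbE; apply/set0Pn; exists v; rewrite inE.
rewrite sub1set in vE.
have sED' : E \subset D.
  by apply: subset_trans sED _; apply/subsetP=> z; rewrite inE => /andP[].
have nadjE z : z \in E -> ~~ adj z y.
  by move/(subsetP sED); rewrite inE => /andP[].
have [w /nbhd_inP[wD wE [a aE aw]]] : exists w, w \in nbhd_in D E.
  apply/set0Pn; apply/eqP => nb0.
  have E0 : E != set0 by apply/set0Pn; exists v.
  have eqED := connected_nbhd0 conD sED' E0 nb0.
  by have [b] := nbrK y yK; rewrite -eqED => /nadjE/negP.
have wy : adj w y.
  apply: contraT => wy.
  suff : w \in nbhd_in [set z in D | ~~ adj z y] E by rewrite nbE inE.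
  by apply/nbhd_inP; split=> //; [rewrite inE wD | exists a].
have conE' := connectedU1 conE aE aw.
have notK z : z \in K -> z \notin w |: E.
  move=> zK; rewrite !inE negb_or; have zD := disjointFr disKD zK.
  apply/andP; split; first by apply: contraFneq zD => ->.
  by apply: contraFN zD; apply: (subsetP sED').
(* In w |: E only w is adjacent to y, so the common neighbour is w. *)
have wx x : x \in K -> adj v x -> adj w x.
  move=> xK vx.
  have ne_xy : x != y by apply: contraNneq vy => <-.
  have xy : adj x y.
    by have /forall_inP/(_ x xK)/forall_inP/(_ y yK)/implyP := cliqueK; apply.
  have xv : adj x v by rewrite adj_sym.
  have yw : adj y w by rewrite adj_sym.
  have [||c] := chordal_common_neighbour conE' xy (notK x xK) (notK y yK) _ xv _ yw.
  - by rewrite inE vE orbT.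
  - by rewrite setU11.
  case/setU1P=> [-> /andP[xw _] | /nadjE]; first by rewrite adj_sym.
  by rewrite adj_sym => /negP nyc /andP[_ /nyc].
have le_deg : deg w <= deg v := maxv w wD.
suff : deg v < deg w by rewrite ltnNge le_deg.
apply: proper_card; apply/properP; split.
  by apply/subsetP => x; rewrite !inE => /andP[xK vx]; rewrite xK wx.
by exists y; rewrite !inE yK // (negPf vy).
Qed.

(** [D] is a smallest connected set in [W] with at least [k] vertices and a
clique as neighbourhood, and [v] is complete to that clique.  A large connected
set in [D :\ v] would extend to a component with neighbours only in the clique
[v |: nbhd_in W D], against the choice of [D]. *)
Lemma chordal_separator k W C :
    0 < k -> connected C -> C \subset W -> k <= #|C| ->
  exists D v, [/\ D \subset W, k <= #|D|, v \in D,
    clique (v |: nbhd_in W D) &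
    forall C', connected C' -> C' \subset D :\ v -> #|C'| < k].
Proof.
move=> k_gt0 conC sCW leC.
pose P D := [&& connected D, D \subset W, k <= #|D| & clique (nbhd_in W D)].
have card_gt0 (D : {set G}) : k <= #|D| -> D != set0.
  by move=> leD; rewrite -card_gt0 (leq_trans k_gt0).
have [D0 PD0] : exists D, P D.
  have [E [conE sCE sEW /(_ (card_gt0 _ leC)) nbE]] := connected_component conC sCW.
  exists E; rewrite /P conE sEW nbE (leq_trans leC (subset_leq_card sCE)).
  by apply/forall_inP => x; rewrite inE.
have [D /and4P[conD sDW leD cliqueD] minD] := arg_minnP (fun D : {set G} => #|D|) PD0.
have [|x /nbhd_inP[_ _] //|v vD adjv] :=
  chordal_complete_vertex conD (card_gt0 _ leD) cliqueD.
  apply/pred0P => x /=; apply/negP => /andP[/nbhd_inP[_ xD _]].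
  by apply/negP.
have cliqueK := clique_cone cliqueD adjv.
exists D, v; split=> // C' conC' sC'; rewrite ltnNge; apply/negP => leC'.
have [E [conE sCE sED /(_ (card_gt0 _ leC')) nbE]] := connected_component conC' sC'.
have sED' := subset_trans sED (subsetDl _ _).
have /minD : P E.
  rewrite /P conE (subset_trans sED' sDW) (leq_trans leC' (subset_leq_card sCE)).
  apply: cliqueS cliqueK; apply/subsetP => x /nbhd_inP[xW xE [d dE dx]].
  have [// | ne_xv] := eqVneq x v; first by move=> ->; rewrite setU11.
  rewrite !inE (negPf ne_xv) xW andbT /=; apply/andP; split.
    apply/negP => xD; suff : x \in nbhd_in (D :\ v) E by rewrite nbE inE.
    by apply/nbhd_inP; split=> //; [rewrite !inE ne_xv | exists d].
  by apply/exists_inP; exists d => //; apply: (subsetP sED').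
by rewrite leqNgt (leq_ltn_trans (subset_leq_card sED)) // [ltnRHS](cardsD1 v) vD.
Qed.

(** Stated for vertex subsets [W] of a fixed graph, so that the induction
deletes vertices without building subgraphs and with the same clique number
throughout. *)
Lemma chordal_fragmentation k W : 0 < k ->
  exists2 S : {set G},
    forall C, connected C -> C \subset W :\: S -> #|C| < k &
    #|S| * (clique_number G + k.-1) <= clique_number G * #|W|.
Proof.
move=> k_gt0; have [m] := ubnP #|W|; elim: m W => // m IHm W lt_Wm.
have [/existsP[C0 /and3P[conC0 sC0W leC0]] | small] :=
  boolP [exists C, [&& connected C, C \subset W & k <= #|C|]]; last first.
  exists set0; last by rewrite cards0.
  move=> C conC; rewrite setD0 => sCW; rewrite ltnNge.
  by apply: contraNN small => leC; apply/existsP; exists C; rewrite conC sCW.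
have [D [v [sDW leD vD cliqueK smallD]]] := chordal_separator k_gt0 conC0 sC0W leC0.
set K := nbhd_in W D in cliqueK.
have disDK : [disjoint D & K].
  apply/pred0P => x /=; apply/negP => /andP[xD /nbhd_inP[_ /negP]]; exact.
have cardDK : #|D :|: K| = #|D| + #|K|.
  by rewrite cardsU disjoint_setI0 // cards0 subn0.
have sKW : K \subset W by apply/subsetP => x /nbhd_inP[].
have vK : v \notin K by rewrite (disjointFr disDK vD).
have cardW : #|W| = #|D| + #|K| + #|W :\: (D :|: K)|.
  by rewrite -cardDK -(cardsID (D :|: K) W) (setIidPr _) // subUset sDW.
have [|S' smallS' cardS'] := IHm (W :\: (D :|: K)); first by lia.
exists (v |: K :|: S') => [C conC sC |]; last first.
  rewrite cardW; apply: (@deletion_count k #|D| #|K| #|S'|) => //.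
    by have := clique_number_max cliqueK; rewrite cardsU1 vK.
  by rewrite (leq_trans (leq_card_setU _ _)) // cardsU1 vK.
have avoid x : x \in C -> [/\ x \in W, x != v, x \notin K & x \notin S'].
  by move/(subsetP sC); rewrite !inE !negb_or => /andP[/andP[/andP[-> ->] ->] ->].
have sCW : C \subset W by apply/subsetP => x /avoid[].
have disCK : [disjoint C & K].
  by apply/pred0P => x /=; apply/negP => /andP[/avoid[_ _ /negP]].
(* Having avoided K, the set C lies either within D or outside of it. *)
have [/existsP[c /andP[cC cD]] | disCD] := boolP [exists c, (c \in C) && (c \in D)].
  apply: smallD => //; apply/subsetP => x xC; have [_ ne_xv _ _] := avoid x xC.
  by rewrite !inE ne_xv (subsetP (connected_confined conC sCW disCK cC cD)).
apply: smallS' => //; apply/subsetP => x xC; have [xW _ xK xS'] := avoid x xC.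
rewrite !in_setD in_setU negb_or xW xK xS' !andbT /=.
by apply: contraNN disCD => xD; apply/existsP; exists x; rewrite xC.
Qed.

End Chordal.

(** * The bound *)

(** A copy of the path would occupy a connected set of [k] vertices. *)
Lemma path_vertex_cover_connected (G : sgraph) k (S : {set G}) :
    (forall C : {set G}, connected C -> C \subset ~: S -> #|C| < k) ->
  path_vertex_cover k S.
Proof.
case: k => [|k] smallC.
  suff: #|(set0 : {set G})| < 0 by [].
  apply: smallC (sub0set _).
  by apply/connectedP => A; rewrite subset0 => /eqP->.
apply/negP => /existsP[f /andP[/injectiveP injf /forallP adjf]].
pose g i := val (f (inord i)).
have : #|[set g (val i) | i : 'I_k.+1]| < k.+1.
  apply: smallC.
    apply: connected_walk => i lt_ik; have /forallP/(_ (inord i.+1)) := adjf (inord i).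
    by rewrite /= /path_adj !inordK ?eqxx //; apply: ltnW.
  by apply/subsetP => _ /imsetP[i _ ->]; rewrite inE; apply: (valP (f _)).
rewrite card_imset ?card_ord ?ltnn // => i j.
by rewrite /g !inord_val => /val_inj/injf.
Qed.

Theorem theorem19 (k : nat) (G : sgraph) (hk : 3 <= k) (hG : chordal G) :
  (((psi G k)%:R : rat) <=
     (clique_number G)%:R / ((clique_number G)%:R + k%:R - 1) * #|G|%:R)%R.
Proof.
have k_gt0 : 0 < k by apply: leq_trans hk.
have [S smallC leS] := chordal_fragmentation hG [set: G] k_gt0.
have {smallC} covS : path_vertex_cover k S.
  by apply: path_vertex_cover_connected => C conC; rewrite -setTD; apply: smallC.
have lepsi := (psiP G k_gt0).2 S covS.
have -> : ((clique_number G)%:R + k%:R - 1 = (clique_number G + k.-1)%:R :> rat)%R.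
  by rewrite -{1}(prednK k_gt0) -addrA -natr1 addrK natrD.
rewrite mulrAC ler_pdivlMr; last by rewrite ltr0n; lia.
by rewrite -!natrM ler_nat -cardsT (leq_trans _ leS) // leq_mul2r lepsi orbT.
Qed.
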